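(* Let $(\mathcal V,w)$ be an isotropic lattice in $\mathbf R^d$ with speed of sound $c_s=3^{-1/2}$, and suppose that the support of $X_\alpha$ is in $[-1,1]$ for every $\alpha\in\{1,\dots,d\}$. Let $\alpha,\beta,\gamma\in\{1,\dots,d\}$ be pairwise distinct. Then there exist constants $c\in[0,\frac1{72}]$ and $c_\alpha,c_\beta,c_\gamma\in[-\frac1{72},\frac1{72}]$ such that (i) $P(X_\alpha=X_\beta=X_\gamma=0)=\frac13-8c$; (ii) $P(X_\alpha=\sigma_\alpha,X_\beta=X_\gamma=0)=\frac1{18}+4c+4\sigma_\alpha c_\alpha$ for $\sigma_\alpha\in\{-1,1\}$; (iii) $P(X_\alpha=\sigma_\alpha,X_\beta=\sigma_\beta,X_\gamma=0)=\frac1{36}-2c-2\sigma_\alpha c_\alpha-2\sigma_\beta c_\beta$ for $\sigma_\alpha,\sigma_\beta\in\{-1,1\}$; (iv) $P(X_\alpha=\sigma_\alpha,X_\beta=\sigma_\beta,X_\gamma=\sigma_\gamma)=c+\sigma_\alpha c_\alpha+\sigma_\beta c_\beta+\sigma_\gamma c_\gamma$ for $\sigma_\alpha,\sigma_\beta,\sigma_\gamma\in\{-1,1\}$. Moreover, these constants satisfy $|c_\alpha|+|c_\beta|+|c_\gamma|\le c$ and $c+|c_\zeta|+|c_\eta|\le\frac1{72}$ for any $\zeta,\eta\in\{\alpha,\beta,\gamma\}$ with $\zeta\ne\eta$.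
   Context: A lattice in $\mathbf R^d$ is a pair $(\mathcal V,w)$ where $\mathcal V=\{v_0=0,v_1,\dots,v_n\}\subset\mathbf R^d$ is a set of pairwise distinct velocities ($n\in\mathbf N$) and $w=(w_0,\dots,w_n)$ is a vector of strictly positive weights. It is isotropic with speed of sound $c_s>0$ if for all indices $\alpha,\beta,\gamma,\zeta\in\{1,\dots,d\}$ ($v_{i,\alpha}$ is the $\alpha$-component of $v_i$): $\sum_i w_i=1$, $\sum_i w_iv_{i,\alpha}=0$, $\sum_i w_iv_{i,\alpha}v_{i,\beta}=c_s^2\delta_{\alpha\beta}$, $\sum_i w_iv_{i,\alpha}v_{i,\beta}v_{i,\gamma}=0$, $\sum_i w_iv_{i,\alpha}v_{i,\beta}v_{i,\gamma}v_{i,\zeta}=c_s^4(\delta_{\alpha\beta}\delta_{\gamma\zeta}+\delta_{\alpha\gamma}\delta_{\beta\zeta}+\delta_{\alpha\zeta}\delta_{\beta\gamma})$. To a lattice one associates the measure $P$ on $\{0,1,\dots,n\}$ with $P(\{i\})=w_i$ and the functions $X_\alpha(i)=v_{i,\alpha}$, $\alpha\in\{1,\dots,d\}$. ''The support of $X_\alpha$ is in $[-1,1]$'' means $v_{i,\alpha}\in[-1,1]$ for all $i$. *)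

(* Defs.v *)
From HB Require Import structures.
From mathcomp Require Import all_boot all_order all_algebra.
From mathcomp Require Import all_classical all_reals all_analysis.

Set Implicit Arguments.
Unset Strict Implicit.
Unset Printing Implicit Defensive.

Import Order.TTheory GRing.Theory Num.Theory.
Import numFieldNormedType.Exports.

Local Open Scope classical_set_scope.
Local Open Scope ring_scope.

HB.instance Definition _ (n : nat) := isPointed.Build 'I_n.+1 ord0.

(* The index set {0, ..., n} carries the discrete sigma-algebra. *)
HB.instance Definition _ (n : nat) :=
  @isMeasurable.Build default_measure_display 'I_n.+1
    discrete_measurable discrete_measurable0
    discrete_measurableC discrete_measurableU.

(* The set of velocities {v_0 = 0, ..., v_n} is encoded by its enumeration;
   [velocity_inj] says that the v_i are pairwise distinct. *)
Record lattice (R : realType) (d n : nat) := Lattice {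
  velocity : 'I_n.+1 -> 'rV[R]_d ;
  weight : 'I_n.+1 -> R ;
  velocity0 : velocity ord0 = 0 ;
  velocity_inj : injective velocity ;
  weight_gt0 : forall i, 0 < weight i
}.

Section Lattice.
Context {R : realType} {d n : nat} (L : lattice R d n).

Definition X (a : 'I_d) (i : 'I_n.+1) : R := velocity L i ord0 a.

Definition kronecker (a b : 'I_d) : R := (a == b)%:R.

Definition isotropic (cs : R) : Prop :=
  0 < cs /\
  \sum_i weight L i = 1 /\
  (forall a, \sum_i weight L i * X a i = 0) /\
  (forall a b, \sum_i weight L i * X a i * X b i = cs ^+ 2 * kronecker a b) /\
  (forall a b c, \sum_i weight L i * X a i * X b i * X c i = 0) /\
  (forall a b c e, \sum_i weight L i * X a i * X b i * X c i * X e i =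
     cs ^+ 4 * (kronecker a b * kronecker c e + kronecker a c * kronecker b e
                + kronecker a e * kronecker b c)).

(* For arbitrary (not necessarily normalised) weights this is a measure;
   it is a probability measure as soon as the weights sum to 1. *)
Definition latticeP (A : set 'I_n.+1) : \bar R :=
  (\sum_(i < n.+1) (weight L i)%:E * \d_i A)%E.

Let nngw (i : 'I_n.+1) : {nonneg R} := NngNum (ltW (weight_gt0 L i)).

Let latticePE :
  latticeP = msum (fun k => mscale (nngw (inord k)) \d_(inord k : 'I_n.+1)) n.+1.
Proof.
apply/funext => A; rewrite /latticeP /msum; apply: eq_bigr => i _.
by rewrite /mscale /= inord_val.
Qed.

Let latticeP0 : latticeP set0 = 0%E.
Proof. by rewrite latticePE measure0. Qed.

Let latticeP_ge0 A : (0 <= latticeP A)%E.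
Proof. by rewrite latticePE. Qed.

Let latticeP_sigma_additive : semi_sigma_additive latticeP.
Proof. rewrite latticePE; exact: measure_semi_sigma_additive. Qed.

HB.instance Definition _ := isMeasure.Build _ _ _ latticeP
  latticeP0 latticeP_ge0 latticeP_sigma_additive.

Lemma latticeP_sum (A : set 'I_n.+1) :
  latticeP A = (\sum_(i < n.+1 | i \in A) weight L i)%:E.
Proof.
rewrite /latticeP -sumEFin [RHS]big_mkcond /=; apply: eq_bigr => i _.
by rewrite diracE; case: (i \in A); rewrite ?mule1 ?mule0.
Qed.

Lemma latticeP1 i : latticeP [set i] = (weight L i)%:E.
Proof. by rewrite latticeP_sum (big_pred1 i) // => j; apply/idP/eqP => [|->]; rewrite inE. Qed.

End Lattice.

(* Main.v *)
(* As E[X_a^2] = E[X_a^4] and |X_a| <= 1, every X_a takes its values in {-1,0,1}.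
   Hence the indicator of X_a = s is a quadratic polynomial in X_a, and the joint
   law of three coordinates is determined by the 27 moments with all exponents at
   most 2.  Isotropy prescribes the 23 of them of degree at most 4; the remaining
   four are 8c = E[X_a^2 X_b^2 X_g^2] and 8c_a = E[X_a X_b^2 X_g^2] with its two
   permutations.  The inequalities express that probabilities are nonnegative. *)
Require Import Defs.
From HB Require Import structures.
From mathcomp Require Import all_boot all_order all_algebra.
From mathcomp Require Import all_classical all_reals all_analysis.
From mathcomp Require Import ring lra.

Set Implicit Arguments.
Unset Strict Implicit.
Unset Printing Implicit Defensive.

Import Order.TTheory GRing.Theory Num.Theory.
Import numFieldNormedType.Exports.

Local Open Scope classical_set_scope.
Local Open Scope ring_scope.

Lemma sqrt3V_exp2 (R : realType) : (Num.sqrt 3 : R)^-1 ^+ 2 = 1 / 3.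
Proof. by rewrite exprVn sqr_sqrtr ?ler0n // div1r. Qed.

(** Explicit ordinals let [/=] compute the exponents, coefficients and [nseq] blocks indexed by
    them. *)
Lemma sum_ord3 (V : nmodType) (F : 'I_3 -> V) :
  \sum_j F j = F (@Ordinal 3 0 isT) + F (@Ordinal 3 1 isT) + F (@Ordinal 3 2 isT).
Proof.
rewrite !big_ord_recr big_ord0 /= add0r.
by congr (F _ + F _ + F _); apply: val_inj.
Qed.

(* Coefficients of the polynomial of degree 2 which is 1 at [s] and 0 at the
   other two points of {-1,0,1}, for [s] in {-1,0,1}. *)
Definition indic_coef (R : realType) (s : R) (j : nat) : R :=
  nth 0 [:: 1 - s ^+ 2; s / 2; 3 / 2 * s ^+ 2 - 1] j.

Lemma indic_coefE (R : realType) (s x : R) :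
  s \in [:: -1; 0; 1] -> x \in [:: -1; 0; 1] ->
  \sum_(j < 3) indic_coef s j * x ^+ j = (x == s)%:R.
Proof.
have neq0N1 : (0 == -1 :> R) = false by apply/eqP; lra.
have neq1N1 : (1 == -1 :> R) = false by apply/eqP; lra.
rewrite !inE sum_ord3 /indic_coef /=.
by move=> /or3P[] /eqP -> /or3P[] /eqP ->;
  rewrite ?eqxx ?oppr_eq0 ?[_ == 0 :> R]oner_eq0 ?[-1 == _ :> R]eq_sym
    ?[0 == 1 :> R]eq_sym ?oner_eq0 ?oppr_eq0 ?oner_eq0 ?neq0N1 ?neq1N1 /=; field.
Qed.

Lemma indic_coef0 (R : realType) :
  ((indic_coef 0 0 = 1 :> R) * (indic_coef 0 1 = 0 :> R)
   * (indic_coef 0 2 = -1 :> R))%type.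
Proof. by rewrite /indic_coef /=; do !split; field. Qed.

Lemma indic_coef_sign (R : realType) (s : R) : s \in [:: -1; 1] ->
  ((indic_coef s 0 = 0) * (indic_coef s 1 = s / 2)
   * (indic_coef s 2 = 1 / 2))%type.
Proof.
by rewrite /indic_coef /= !inE => /orP[] /eqP ->; do !split; field.
Qed.

Section Moments.
Context {R : realType} {d n : nat} (L : lattice R d n).

(** A mixed moment is encoded by the list of its factors: its degree is the [size], and
    commutativity becomes [perm_eq]. *)
Definition moment (s : seq 'I_d) : R :=
  \sum_i weight L i * \prod_(a <- s) X L a i.

Lemma moment_perm s t : perm_eq s t -> moment s = moment t.
Proof. by move=> st; apply: eq_bigr => i _; rewrite (perm_big t). Qed.

Hypothesis Liso : isotropic L (Num.sqrt 3)^-1.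

(** The isotropy identities merged into one rewrite rule, with c_s^2 = 1/3 and c_s^4 = 1/9. *)
Lemma moment_le4 s : (size s <= 4)%N -> moment s =
  match s with
  | [::] => 1
  | [:: a; b] => kronecker a b / 3
  | [:: a; b; c; e] =>
      (kronecker a b * kronecker c e + kronecker a c * kronecker b e
       + kronecker a e * kronecker b c) / 9
  | _ => 0
  end.
Proof.
have [_ [m0 [m1 [m2 [m3 m4]]]]] := Liso; rewrite /moment.
have cs4 : (Num.sqrt 3 : R)^-1 ^+ 4 = 1 / 9.
  by rewrite (exprM _ 2 2) sqrt3V_exp2; field.
case: s => [|a [|b [|c [|e []]]]] //= _.
- by rewrite -[RHS]m0; apply: eq_bigr => i _; rewrite big_nil mulr1.
- by rewrite -[RHS](m1 a); apply: eq_bigr => i _; rewrite !big_cons big_nil mulr1.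
- rewrite [RHS]mulrC -[_^-1]div1r -sqrt3V_exp2 -(m2 a b).
  by apply: eq_bigr => i _; rewrite !big_cons big_nil mulr1 !mulrA.
- rewrite -[RHS](m3 a b c).
  by apply: eq_bigr => i _; rewrite !big_cons big_nil mulr1 !mulrA.
- rewrite [RHS]mulrC -[_^-1]div1r -cs4 -(m4 a b c e).
  by apply: eq_bigr => i _; rewrite !big_cons big_nil mulr1 !mulrA.
Qed.

Hypothesis Lsupp : forall (a : 'I_d) (i : 'I_n.+1), -1 <= X L a i <= 1.

(** The second and fourth moments agree because 3 c_s^4 = 1/3 = c_s^2. On [-1,1] every term w (X^2 -
    X^4) is nonnegative, so a zero sum makes each one vanish; as w > 0, the value of X is a root of
    x^2 (x + 1) (1 - x). *)
Lemma X_support a i : X L a i \in [:: -1; 0; 1].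
Proof.
have sum0 : \sum_i weight L i * (X L a i ^+ 2 - X L a i ^+ 4) = 0.
  transitivity (moment [:: a; a] - moment [:: a; a; a; a]).
    rewrite /moment -sumrB; apply: eq_bigr => j _.
    by rewrite !big_cons big_nil; ring.
  by rewrite !moment_le4 //= /kronecker eqxx mulr1n; field.
have ge0 j : true -> 0 <= weight L j * (X L a j ^+ 2 - X L a j ^+ 4).
  move=> _; rewrite mulr_ge0 ?(ltW (weight_gt0 L j)) //.
  have /andP[? ?] := Lsupp a j.
  have -> : X L a j ^+ 2 - X L a j ^+ 4 =
    X L a j ^+ 2 * ((1 - X L a j) * (1 + X L a j)) by ring.
  by rewrite mulr_ge0 ?sqr_ge0 // mulr_ge0 //; lra.
have /(_ i isT)/eqP := psumr_eq0P ge0 sum0.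
rewrite mulf_eq0 gt_eqF ?weight_gt0 //=.
have -> : X L a i ^+ 2 - X L a i ^+ 4 =
  X L a i * X L a i * ((X L a i + 1) * (1 - X L a i)) by ring.
rewrite !mulf_eq0 orbb addr_eq0 subr_eq0 !inE [1 == _]eq_sym.
by case/or3P => ->; rewrite ?orbT.
Qed.

(** On {-1,0,1} one has x^3 = x. *)
Lemma moment_cube a s : moment [:: a, a, a & s] = moment (a :: s).
Proof.
apply: eq_bigr => i _; rewrite !big_cons; congr (_ * _).
by move: (X_support a i); rewrite !inE => /or3P[] /eqP ->; ring.
Qed.

(** The indicator of the event is a product of three interpolation polynomials, which is expanded
    under the sum. *)
Lemma latticeP_moment a b g (sa sb sg : R) :
  sa \in [:: -1; 0; 1] -> sb \in [:: -1; 0; 1] -> sg \in [:: -1; 0; 1] ->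
  latticeP L [set i | X L a i = sa /\ X L b i = sb /\ X L g i = sg] =
  (\sum_(j < 3) \sum_(k < 3) \sum_(m < 3)
    indic_coef sa j * indic_coef sb k * indic_coef sg m *
    moment (nseq j a ++ nseq k b ++ nseq m g))%:E.
Proof.
move=> sa3 sb3 sg3; rewrite latticeP_sum; congr (_%:E).
transitivity (\sum_i weight L i *
  ((\sum_(j < 3) indic_coef sa j * X L a i ^+ j) *
   (\sum_(j < 3) indic_coef sb j * X L b i ^+ j) *
   (\sum_(j < 3) indic_coef sg j * X L g i ^+ j))).
  rewrite big_mkcond; apply: eq_bigr => i _.
  rewrite !indic_coefE ?X_support // -!natrM !mulnb.
  suff -> : (i \in [set i | X L a i = sa /\ X L b i = sb /\ X L g i = sg]) =
    (X L a i == sa) && (X L b i == sb) && (X L g i == sg).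
    by case: ifP; rewrite ?mulr1 ?mulr0.
  apply/idP/idP => [|/andP[/andP[/eqP ? /eqP ?] /eqP ?]]; rewrite inE //=.
  by case=> -> [-> ->]; rewrite !eqxx.
have momentE j k m : moment (nseq j a ++ nseq k b ++ nseq m g) =
    \sum_i weight L i * (X L a i ^+ j * X L b i ^+ k * X L g i ^+ m).
  apply: eq_bigr => i _.
  by rewrite !big_cat /= !big_nseq !iter_mulr_1 -mulrA.
rewrite !sum_ord3 !momentE /= !mulr_sumr -!big_split /=.
by apply: eq_bigr => i _; rewrite !sum_ord3 /=; ring.
Qed.

(* The moments of degree 5 carry an extra square, which changes nothing because
   X^3 = X, so that all three have the form E[X_z (X_a X_b X_g)^2]. *)
Lemma latticeP3 a b g (sa sb sg : R) :
  a != b -> a != g -> b != g ->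
  sa \in [:: -1; 0; 1] -> sb \in [:: -1; 0; 1] -> sg \in [:: -1; 0; 1] ->
  latticeP L [set i | X L a i = sa /\ X L b i = sb /\ X L g i = sg] =
  (indic_coef sa 0 * indic_coef sb 0 * indic_coef sg 0
   + (indic_coef sa 2 * indic_coef sb 0 * indic_coef sg 0
      + indic_coef sa 0 * indic_coef sb 2 * indic_coef sg 0
      + indic_coef sa 0 * indic_coef sb 0 * indic_coef sg 2) / 3
   + (indic_coef sa 2 * indic_coef sb 2 * indic_coef sg 0
      + indic_coef sa 2 * indic_coef sb 0 * indic_coef sg 2
      + indic_coef sa 0 * indic_coef sb 2 * indic_coef sg 2) / 9
   + indic_coef sa 2 * indic_coef sb 2 * indic_coef sg 2
     * moment [:: a; a; b; b; g; g]
   + indic_coef sa 1 * indic_coef sb 2 * indic_coef sg 2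
     * moment [:: a; a; a; b; b; g; g]
   + indic_coef sa 2 * indic_coef sb 1 * indic_coef sg 2
     * moment [:: b; a; a; b; b; g; g]
   + indic_coef sa 2 * indic_coef sb 2 * indic_coef sg 1
     * moment [:: g; a; a; b; b; g; g])%:E.
Proof.
move=> ab ag bg sa3 sb3 sg3; rewrite latticeP_moment //; congr (_%:E).
(* Gathering the three copies of [b] in front lets [moment_cube] remove two of them; [permP] turns
   each reordering into an identity between sums of counts. *)
have eb : moment [:: b; a; a; b; b; g; g] = moment [:: a; a; b; g; g].
  rewrite (@moment_perm _ [:: b, b, b & [:: a; a; g; g]]).
    rewrite moment_cube; apply: moment_perm.
    by apply/permP => p /=; ring.
  by apply/permP => p /=; ring.
have eg : moment [:: g; a; a; b; b; g; g] = moment [:: a; a; b; b; g].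
  rewrite (@moment_perm _ [:: g, g, g & [:: a; a; b; b]]).
    rewrite moment_cube; apply: moment_perm.
    by apply/permP => p /=; ring.
  by apply/permP => p /=; ring.
rewrite moment_cube eb eg !sum_ord3 /=.
(* The moments of degree at least 5; [moment_le4] applies to all the others. *)
move: (moment [:: a; a; b; b; g; g]) (moment [:: a; b; b; g; g])
  (moment [:: a; a; b; g; g]) (moment [:: a; a; b; b; g]) => mabg ma mb mg.
(* As [a], [b], [g] are distinct, what survives in degree at most 4 is the total mass 1, the squares
   (1/3) and the products of two different squares (1/9). *)
rewrite !moment_le4 //= /kronecker !eqxx (negbTE ab) (negbTE ag) (negbTE bg).
by rewrite mulr0n mulr1n /indic_coef /=; field.
Qed.

End Moments.

Theorem proposition22 (R : realType) (d n : nat) (L : lattice R d n)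
  (Liso : isotropic L (Num.sqrt 3)^-1)
  (Lsupp : forall (a : 'I_d) (i : 'I_n.+1), -1 <= X L a i <= 1)
  (alpha beta gamma : 'I_d)
  (neq_ab : alpha != beta) (neq_ag : alpha != gamma) (neq_bg : beta != gamma) :
  exists (c : R) (k : 'I_d -> R),
    [/\ 0 <= c <= 1 / 72,
        forall z, z \in [:: alpha; beta; gamma] -> - (1 / 72) <= k z <= 1 / 72 &
    [/\ latticeP L [set i | X L alpha i = 0 /\ X L beta i = 0 /\ X L gamma i = 0]
          = (1 / 3 - 8 * c)%:E,
        forall sa : R, sa \in [:: -1; 1] ->
          latticeP L
            [set i | X L alpha i = sa /\ X L beta i = 0 /\ X L gamma i = 0]
          = (1 / 18 + 4 * c + 4 * sa * k alpha)%:E,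
        forall sa sb : R, sa \in [:: -1; 1] -> sb \in [:: -1; 1] ->
          latticeP L
            [set i | X L alpha i = sa /\ X L beta i = sb /\ X L gamma i = 0]
          = (1 / 36 - 2 * c - 2 * sa * k alpha - 2 * sb * k beta)%:E &
        forall sa sb sg : R, sa \in [:: -1; 1] -> sb \in [:: -1; 1] ->
          sg \in [:: -1; 1] ->
          latticeP L
            [set i | X L alpha i = sa /\ X L beta i = sb /\ X L gamma i = sg]
          = (c + sa * k alpha + sb * k beta + sg * k gamma)%:E] /\
    (`|k alpha| + `|k beta| + `|k gamma| <= c /\
     forall z e, z \in [:: alpha; beta; gamma] -> e \in [:: alpha; beta; gamma] ->
       z != e -> c + `|k z| + `|k e| <= 1 / 72)].
Proof.
set M := moment L.
have S3 (s : R) : s \in [:: -1; 1] -> s \in [:: -1; 0; 1].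
  by rewrite !inE => /orP[] ->; rewrite ?orbT.
have z3 : 0 \in [:: -1; 0; 1 : R] by rewrite !inE eqxx orbT.
(* The 1/8 is the product of three coefficients of modulus 1/2 in the indicator polynomials at 1 or
   -1; it makes [c] and [k] the coefficients in (iv). *)
pose c := M [:: alpha; alpha; beta; beta; gamma; gamma] / 8.
pose k z := M [:: z; alpha; alpha; beta; beta; gamma; gamma] / 8.
pose P sa sb sg := latticeP L
  [set i | X L alpha i = sa /\ X L beta i = sb /\ X L gamma i = sg].
have P000 : P 0 0 0 = (1 / 3 - 8 * c)%:E.
  by rewrite /P latticeP3 // !indic_coef0; congr EFin; rewrite /c /M; field.
have Pa sa : sa \in [:: -1; 1] ->
    P sa 0 0 = (1 / 18 + 4 * c + 4 * sa * k alpha)%:E.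
  move=> a2; rewrite /P latticeP3 ?(S3 _ a2) // !indic_coef0.
  by rewrite !(indic_coef_sign a2); congr EFin; rewrite /c /k /M; field.
have Pab sa sb : sa \in [:: -1; 1] -> sb \in [:: -1; 1] ->
    P sa sb 0 = (1 / 36 - 2 * c - 2 * sa * k alpha - 2 * sb * k beta)%:E.
  move=> a2 b2; rewrite /P latticeP3 ?(S3 _ a2) ?(S3 _ b2) // !indic_coef0.
  rewrite !(indic_coef_sign a2) !(indic_coef_sign b2); congr EFin.
  by rewrite /c /k /M; field.
(* The remaining two pairs serve only for the inequalities. *)
have Pag sa sg : sa \in [:: -1; 1] -> sg \in [:: -1; 1] ->
    P sa 0 sg = (1 / 36 - 2 * c - 2 * sa * k alpha - 2 * sg * k gamma)%:E.
  move=> a2 g2; rewrite /P latticeP3 ?(S3 _ a2) ?(S3 _ g2) // !indic_coef0.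
  rewrite !(indic_coef_sign a2) !(indic_coef_sign g2); congr EFin.
  by rewrite /c /k /M; field.
have Pbg sb sg : sb \in [:: -1; 1] -> sg \in [:: -1; 1] ->
    P 0 sb sg = (1 / 36 - 2 * c - 2 * sb * k beta - 2 * sg * k gamma)%:E.
  move=> b2 g2; rewrite /P latticeP3 ?(S3 _ b2) ?(S3 _ g2) // !indic_coef0.
  rewrite !(indic_coef_sign b2) !(indic_coef_sign g2); congr EFin.
  by rewrite /c /k /M; field.
have Pabg sa sb sg :
    sa \in [:: -1; 1] -> sb \in [:: -1; 1] -> sg \in [:: -1; 1] ->
    P sa sb sg = (c + sa * k alpha + sb * k beta + sg * k gamma)%:E.
  move=> a2 b2 g2.
  rewrite /P latticeP3 ?(S3 _ a2) ?(S3 _ b2) ?(S3 _ g2) //; congr EFin.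
  rewrite !(indic_coef_sign a2) !(indic_coef_sign b2) !(indic_coef_sign g2).
  by rewrite /c /k /M; field.
(* The sign opposite to that of [x], which makes [s * x] as small as possible; such signs select the
   least probability in a family. *)
have signE (x : R) : exists2 s, s \in [:: -1; 1] & `|x| = - (s * x).
  have [x0|x0] := leP 0 x; [exists (-1)|exists 1]; rewrite ?inE ?eqxx ?orbT //.
    by rewrite ger0_norm // mulN1r opprK.
  by rewrite ltr0_norm // mul1r.
have [sa sa2 na] := signE (k alpha).
have [sb sb2 nb] := signE (k beta).
have [sg sg2 ng] := signE (k gamma).
have signN (s : R) : s \in [:: -1; 1] -> - s \in [:: -1; 1].
  by rewrite !inE => /orP[] /eqP ->; rewrite ?opprK eqxx ?orbT.
have P_ge0 s t u : (0 <= P s t u)%E by exact: measure_ge0.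
have babg : `|k alpha| + `|k beta| + `|k gamma| <= c.
  by have := P_ge0 sa sb sg; rewrite Pabg // lee_fin; lra.
(* In (iii) the [k] terms enter with a minus, so the signs are reversed: the least value is 1/36 - 2
   (c + |k alpha| + |k beta|). *)
have bab : c + `|k alpha| + `|k beta| <= 1 / 72.
  by have := P_ge0 (- sa) (- sb) 0; rewrite Pab ?signN // lee_fin; lra.
have bag : c + `|k alpha| + `|k gamma| <= 1 / 72.
  by have := P_ge0 (- sa) 0 (- sg); rewrite Pag ?signN // lee_fin; lra.
have bbg : c + `|k beta| + `|k gamma| <= 1 / 72.
  by have := P_ge0 0 (- sb) (- sg); rewrite Pbg ?signN // lee_fin; lra.
have na0 := normr_ge0 (k alpha); have nb0 := normr_ge0 (k beta).
have ng0 := normr_ge0 (k gamma).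
(* [babg] gives 0 <= c; the pair bounds then give c <= 1/72 and bound each |k z| by 1/72. *)
exists c, k; split; [by lra| |split; split => //].
  by move=> z zabg; rewrite -ler_norml; move: zabg;
    rewrite !inE => /or3P[] /eqP ->; lra.
by move=> z e; rewrite !inE => /or3P[] /eqP -> /or3P[] /eqP -> => neq;
  rewrite ?eqxx // in neq *; lra.
Qed.
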